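(* Let $(k_n)_{n\in\mathbb{N}}$ be an increasing sequence of natural numbers such that $k_1>1$ and the set $\mathbb{N}\setminus\{k_n:n\in\mathbb{N}\}$ is infinite; put $k_0=0$. Let $$x_j=\left\{\begin{array}{ll}\frac{2}{3^{j-1}}&\text{if }j\in\{k_n:n\in\mathbb{N}\},\\ \frac{1}{3^{j-1}}&\text{if }j\notin\{k_n:n\in\mathbb{N}\},\end{array}\right.$$ $S=\sum_{j=1}^\infty x_j$, $r_n=\sum_{j=n+1}^\infty x_j$ for $n\ge0$, and $\lambda_n=\frac{r_n}{r_{n-1}}$ for $n\in\mathbb{N}$. Then: (1) The sequence $\lambda=(\lambda_j)$ is the only sequence with the following properties: $(\lambda_j)\in(0,\frac12)^{\mathbb{N}}$, $\lambda_1>\frac13$, $\lambda_{k_n}<\frac13$ for all $n\in\mathbb{N}$, $\lambda_j\ge\frac13$ if $j\notin\{k_n:n\in\mathbb{N}\}$, and, with $d_0=1$ and $d_n=\lambda_1\cdots\lambda_n$, there exists a sequence $(\delta_n)_{n\in\mathbb{N}}$ of real numbers such that for every $n\in\mathbb{N}$ $$\left\{\begin{array}{l}3d_r-d_{r-1}=\delta_n \text{ whenever } k_{n-1}<r<k_n,\\ 4d_{k_n}=\delta_n+\delta_{n+1},\\ d_{k_n-1}-d_{k_n}=\delta_n-\delta_{n+1}.\end{array}\right.$$ (2) The set $E(x)-E(x)$ is a Cantorval and $E(x)=S\cdot C(\lambda)$.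
   Context: $\mathbb{N}=\{1,2,\dots\}$; $A-B=\{a-b:a\in A,b\in B\}$ and $S\cdot A=\{Sa:a\in A\}$. Achievement set: for a sequence $x=(x_j)$ of positive numbers with $\sum_j x_j$ convergent, $E(x)=\{\sum_{j\in A}x_j:A\subset\mathbb{N}\}$. Central Cantor set: for $\lambda\in(0,\frac12)^{\mathbb{N}}$ put $d_0=1$, $d_n=\lambda_1\cdots\lambda_n$. Let $I_\emptyset=[0,1]$. Given a closed interval $I_t$ of length $d_n$ with $t\in\{0,1\}^n$, remove from it the concentric open interval of length $(1-2\lambda_{n+1})d_n$; the left and right remaining components are $I_{t^\frown 0}$ and $I_{t^\frown 1}$ (where $^\frown$ is concatenation), each of length $d_{n+1}$. Put $C_n(\lambda)=\bigcup_{t\in\{0,1\}^n}I_t$ and $C(\lambda)=\bigcap_{n\in\mathbb{N}}C_n(\lambda)$. Cantorval: a set is regular closed if it equals the closure of its interior. A nonempty regular closed bounded set $C\subset\mathbb{R}$ is a Cantorval if for every connected component $K$ of $C$ with nonempty interior, both endpoints of $K$ are accumulation points of the union of the one-point components of $C$. *)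

(* Defs.v *)
From HB Require Import structures.
From mathcomp Require Import all_boot all_order all_algebra.
From mathcomp Require Import all_classical all_reals all_analysis.
Set Implicit Arguments.
Unset Strict Implicit.
Unset Printing Implicit Defensive.
Import Order.TTheory GRing.Theory Num.Theory.
Import numFieldNormedType.Exports.
Local Open Scope classical_set_scope.
Local Open Scope ring_scope.

(* Sequences indexed by {1, 2, ...} are functions on nat whose value at 0 is
   irrelevant. *)
Definition posnat : set nat := [set n | (0 < n)%N].

Section AchievementSet.
Variable R : realType.

Definition achievement_set (x : nat -> R) : set R :=
  [set \big[+%R/0]_(1 <= j <oo | j \in A) x j | A in [set A | A `<=` posnat]].

Definition diff_set (A B : set R) : set R := [set a - b | a in A & b in B].

Definition dilate (s : R) (A : set R) : set R := [set s * a | a in A].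

End AchievementSet.

Section CentralCantorSet.
Variables (R : realType) (lam : nat -> R).

Definition cantor_len (n : nat) : R := \prod_(1 <= i < n.+1) lam i.

(* Endpoints of the left (b = false) or right (b = true) component of
   [J.1, J.2] minus the concentric open interval of length l. *)
Definition remove_middle (l : R) (J : R * R) (b : bool) : R * R :=
  let c := (J.1 + J.2) / 2 in
  if b then (c + l / 2, J.2) else (J.1, c - l / 2).

(* The word is read from its last letter: [cantor_ends_rev (rev t)] gives the
   endpoints of I_t, and [rev (rcons t b)] is [b :: rev t]. *)
Fixpoint cantor_ends_rev (t : seq bool) : R * R :=
  if t is b :: u then
    let n := size u in
    remove_middle ((1 - 2 * lam n.+1) * cantor_len n) (cantor_ends_rev u) b
  else (0, 1).

Definition cantor_interval (t : seq bool) : set R :=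
  let J := cantor_ends_rev (rev t) in `[J.1, J.2].

Definition cantor_level (n : nat) : set R :=
  \bigcup_(t in [set t : seq bool | size t = n]) cantor_interval t.

Definition central_cantor : set R := \bigcap_(n in posnat) cantor_level n.

End CentralCantorSet.

Section Cantorval.
Variable R : realType.

Definition point_components (C : set R) : set R :=
  [set p | C p /\ connected_component C p = [set p]].

(* As C is bounded, so is each component K, and its endpoints are
   [inf K] and [sup K]. *)
Definition cantorval (C : set R) : Prop :=
  [/\ C !=set0, regclosed C, bounded_set C &
      forall p, C p ->
        let K := connected_component C p in
        K° !=set0 ->
        limit_point (point_components C) (inf K) /\
        limit_point (point_components C) (sup K)].

End Cantorval.

Definition lambda_conditions (R : realType) (k : nat -> nat) (lam : nat -> R)
    : Prop :=
  let d := cantor_len lam in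
  [/\ forall j, posnat j -> 0 < lam j < 1 / 2,
      1 / 3 < lam 1%N,
      forall n, posnat n -> lam (k n) < 1 / 3,
      forall j, posnat j -> ~ (k @` posnat) j -> 1 / 3 <= lam j &
      exists delta : nat -> R, forall n, posnat n ->
        [/\ forall r, (k n.-1 < r < k n)%N -> 3 * d r - d r.-1 = delta n,
            4 * d (k n) = delta n + delta n.+1 &
            d (k n).-1 - d (k n) = delta n - delta n.+1]].

(* Main.v *)
(* For lambda_n = r_n / r_(n-1) the product d_n telescopes to r_n / S.

   Part (1): put gam m = 2 r_m - 3^(1-m), the sum of the x_j with m < j in the
   range of k.  It is constant between consecutive values of k and gives the
   delta_n after division by S.  For a second solution, d_m - delta_n / 2 with
   k_(n-1) <= m < k_n is divided by 3 at every step, hence d_(m-1) - d_m is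
   proportional to x_m; since d_0 = 1 and d_m -> 0, this determines d.

   Part (2): as r_n < x_n, the sums over subsets of {1, ..., n} are the left
   endpoints of the disjoint intervals of level n, dilated by S.  The digits
   {-1, 0, 1} and {-2, 0, 2} of F = E(x) - E(x) are complete residue systems
   modulo 3, so around every finite signed sum v the compact set F contains an
   interval.  If u is the left endpoint of a gap of F, then u = v_m + r_m with
   v_m a signed sum of length m, for every large m.  Near u only signed sums
   with the same beginning v_m occur, because the others differ from v_m by at
   least 3^(1-m).  For m + 1 = k in the range of k, F therefore misses
   (u - x_k, u - 2 r_k), nonempty as x_k > 2 r_k, and {u} is a component.
   Gaps accumulate at both ends of every nontrivial component. *)
Require Import Defs.
From HB Require Import structures.
From mathcomp Require Import all_boot all_order all_algebra.
From mathcomp Require Import all_classical all_reals all_analysis.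
From mathcomp Require Import ring lra zify.
Set Implicit Arguments.
Unset Strict Implicit.
Unset Printing Implicit Defensive.
Import Order.TTheory GRing.Theory Num.Theory.
Import numFieldNormedType.Exports.
Local Open Scope classical_set_scope.
Local Open Scope ring_scope.

(** * Sums over index sets for a nonnegative sequence with bounded partial sums *)

Section SubsetSums.
Variables (R : realType) (x : nat -> R) (M : R).
Hypothesis x_ge0 : forall j, 0 <= x j.

Definition psum (A : set nat) (n : nat) : R :=
  \sum_(1 <= j < n.+1 | j \in A) x j.

Definition rest (n : nat) : R := \big[+%R/0]_(n.+1 <= j <oo) x j.

Definition subsum (A : set nat) : R := \big[+%R/0]_(1 <= j <oo | j \in A) x j.

Lemma psum0 A : psum A 0 = 0.
Proof. by rewrite /psum big_geq. Qed.

Lemma psumS A n : psum A n.+1 = psum A n + (if n.+1 \in A then x n.+1 else 0).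
Proof. by rewrite /psum big_mkcond big_nat_recr//= -big_mkcond. Qed.

Lemma eq_psum A B n : (forall j, (0 < j <= n)%N -> (j \in A) = (j \in B)) ->
  psum A n = psum B n.
Proof.
move=> AB; rewrite /psum big_nat_cond [RHS]big_nat_cond.
by apply: eq_bigl => j; case: (boolP (0 < j < n.+1)%N) => //= /AB ->.
Qed.

Lemma psum_nd A : nondecreasing_seq (psum A).
Proof.
apply/nondecreasing_seqP => n; rewrite psumS lerDl.
by case: ifP.
Qed.

Lemma psum_tail_le A m n : (m <= n)%N ->
  psum A n - psum A m <= psum setT n - psum setT m.
Proof.
move=> /subnKC <-; elim: (n - m)%N => [|d IH]; first by rewrite addn0 !subrr.
rewrite addnS !psumS in_setT.
by have := x_ge0 (m + d).+1; case: ifP => _; lra.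
Qed.

Hypothesis x_bnd : forall n, psum setT n <= M.

Lemma psum_is_cvg A : cvgn (psum A).
Proof.
apply: nondecreasing_is_cvgn; first exact: psum_nd.
exists M => _ [n _ <-]; apply: le_trans (x_bnd n).
by have := psum_tail_le A (leq0n n); rewrite !psum0 !subr0.
Qed.

Lemma psum_cvg A : psum A n @[n --> \oo] --> subsum A.
Proof.
suff -> : subsum A = limn (psum A) by exact: psum_is_cvg.
(* An infinite sum is the limit of the sums over j < n, while [psum] includes j = n; the shift by
   one reconciles them. *)
apply/cvg_lim => //; rewrite -cvg_shiftS; exact: psum_is_cvg.
Qed.

Lemma rest_cvg n : psum setT m - psum setT n @[m --> \oo] --> rest n.
Proof.
have c : psum setT m - psum setT n @[m --> \oo] --> subsum setT - psum setT n.
  by apply: cvgB; [exact: psum_cvg|exact: cvg_cst].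
suff -> : rest n = subsum setT - psum setT n by [].
apply/cvg_lim => //; rewrite -cvg_shiftS.
apply: cvg_trans c; apply: near_eq_cvg.
near=> m; rewrite /psum.
have nm : (n <= m)%N by near: m; exact: nbhs_infty_ge.
rewrite (big_cat_nat _ (n := n.+1))//= addrAC subrr add0r.
by apply: eq_bigl => j; rewrite in_setT.
Unshelve. all: by end_near. Qed.

Lemma restE n : rest n = subsum setT - psum setT n.
Proof.
apply: cvg_unique (@rest_cvg n) _ => //=.
by apply: cvgB; [exact: psum_cvg|exact: cvg_cst].
Qed.

Lemma rest0E : rest 0 = subsum setT.
Proof. by rewrite restE psum0 subr0. Qed.

Lemma restS n : rest n = x n.+1 + rest n.+1.
Proof. by rewrite !restE psumS in_setT; ring. Qed.

Lemma rest_cvg0 : rest n @[n --> \oo] --> (0 : R).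
Proof.
rewrite -(subrr (subsum setT)) (_ : rest = fun n => subsum setT - psum setT n).
  by apply: cvgB; [exact: cvg_cst|exact: psum_cvg].
by apply/funext => n; exact: restE.
Qed.

Lemma subsum_ge A n : psum A n <= subsum A.
Proof.
have c := @psum_cvg A.
rewrite -(cvg_lim _ c)//; apply: nondecreasing_cvgn_le; first exact: psum_nd.
exact: psum_is_cvg.
Qed.

Lemma subsum_le A n : subsum A <= psum A n + rest n.
Proof.
have c : psum A n + (psum setT m - psum setT n) @[m --> \oo]
    --> psum A n + rest n.
  by apply: cvgD; [exact: cvg_cst|exact: rest_cvg].
apply: ler_cvg_to (@psum_cvg A) c _; near=> m.
have nm : (n <= m)%N by near: m; exact: nbhs_infty_ge.
by have := psum_tail_le A nm; lra.
Unshelve. all: by end_near. Qed.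

Lemma rest_ge0 n : 0 <= rest n.
Proof. by have := subsum_ge set0 n; have := subsum_le set0 n; lra. Qed.

(** Converse to [subsum_ge] and [subsum_le]: as the tails vanish, the intervals from [psum A n] to
    [psum A n + rest n] shrink to a single point. *)
Lemma subsum_eq A (a : R) : (forall n, psum A n <= a <= psum A n + rest n) ->
  subsum A = a.
Proof.
move=> h; apply: cvg_unique (@psum_cvg A) _ => //=.
apply: (@squeeze_cvgr _ _ _ _ (fun n => a - rest n) (fun=> a)).
- by near=> n; have := h n; lra.
- rewrite -[X in _ --> X]subr0; apply: cvgB; [exact: cvg_cst|exact: rest_cvg0].
- exact: cvg_cst.
Unshelve. all: by end_near. Qed.

Lemma psum_cut A n m : (n <= m)%N ->
  psum [set j | A j /\ (j <= n)%N] m = psum A n.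
Proof.
set B := [set j | _]; move=> /subnKC <-; elim: (m - n)%N => [|d IH].
  rewrite addn0; apply: eq_psum => j /andP[_ jn].
  by apply/idP/idP; rewrite !inE /B /=; tauto.
rewrite addnS psumS IH; case: ifPn; last by rewrite addr0.
by rewrite inE /B /=; lia.
Qed.

Lemma subsum_cut A n : subsum [set j | A j /\ (j <= n)%N] = psum A n.
Proof.
set B := [set j | _].
have c : psum B m @[m --> \oo] --> psum A n.
  apply: cvg_near_cst; near=> m; apply/psum_cut.
  by near: m; exact: nbhs_infty_ge.
exact: cvg_unique (@psum_cvg B) c.
Unshelve. all: by end_near. Qed.

Lemma psum_fill A n : psum [set j | A j \/ (n < j)%N] n = psum A n.
Proof.
apply: eq_psum => j /andP[_ jn]; apply/idP/idP; rewrite !inE /=; last by left.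
by case=> //; lia.
Qed.

(** Together with [subsum_cut] this realises both ends of the interval from [psum A n] to
    [psum A n + rest n] as subset sums: all indices beyond n are kept or dropped. *)
Lemma subsum_fill A n :
  subsum [set j | A j \/ (n < j)%N] = psum A n + rest n.
Proof.
set B := [set j | _]; have BA : psum B n = psum A n by exact: psum_fill.
apply/eqP; rewrite eq_le -{1}BA subsum_le /=.
rewrite restE.
have c : psum A n + (psum setT m - psum setT n) @[m --> \oo]
    --> psum A n + (subsum setT - psum setT n).
  by rewrite -restE; apply: cvgD; [exact: cvg_cst|exact: rest_cvg].
apply: ler_cvg_to c (@psum_cvg B) _; near=> m.
have /subnKC <- : (n <= m)%N by near: m; exact: nbhs_infty_ge.
elim: (m - n)%N => [|d IH]; first by rewrite addn0 BA; lra.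
rewrite addnS !psumS in_setT (_ : (n + d).+1 \in B); first by lra.
by rewrite inE /B /=; right; lia.
Unshelve. all: by end_near. Qed.

Lemma subsum_achievement A : achievement_set x (subsum A).
Proof.
(* Index 0 is never summed, so A may be intersected with [posnat]. *)
exists (A `&` posnat); first by move=> j [].
apply: (congr1 (fun f : nat -> R => lim (f @ \oo))); apply/funext => n.
rewrite big_nat_cond [RHS]big_nat_cond; apply: eq_bigl => j.
case: (boolP (0 < j < n)%N) => //= /andP[j0 _].
by apply/idP/idP; rewrite !inE /setI /posnat /=; tauto.
Qed.

Lemma achievement_subsum a : achievement_set x a -> exists A, a = subsum A.
Proof. by case=> A _ <-; exists A. Qed.

End SubsetSums.

(** * Fast convergence: the achievement set as a dilated central Cantor set *)

Section FastConvergence.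
Variables (R : realType) (x : nat -> R) (M : R).
Hypothesis x_ge0 : forall j, 0 <= x j.
Hypothesis x_bnd : forall n, psum x setT n <= M.
Hypothesis rest_lt : forall n, rest x n.+1 < x n.+1.

Let r := rest x.
Let lam n := r n / r n.-1.

Lemma rest_gt0 n : 0 < r n.
Proof.
have := restS x_ge0 x_bnd n; have := rest_lt n.
have := rest_ge0 x_ge0 x_bnd n.+1.
by rewrite /r; lra.
Qed.

Lemma cantor_len_ratio n : cantor_len lam n = r n / r 0.
Proof.
have r0 m : r m != 0 by rewrite gt_eqF// rest_gt0.
elim: n => [|n IH]; first by rewrite /cantor_len big_geq// divff.
rewrite /cantor_len big_nat_recr//= -/(cantor_len lam n) IH /lam /=.
by field; rewrite !r0.
Qed.

(* Words are reversed, as in [cantor_ends_rev]: the head is the last digit. *)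
Fixpoint word_sum (u : seq bool) : R :=
  if u is b :: v then word_sum v + (if b then x (size v).+1 else 0) else 0.

(** The removed length (1 - 2 lam_(n+1)) d_n equals (x_(n+1) - r_(n+1)) / r_0, so the right
    component starts x_(n+1) / r_0 after the left one. *)
Lemma cantor_ends_ratio u : cantor_ends_rev lam u =
  (word_sum u / r 0, (word_sum u + r (size u)) / r 0).
Proof.
have r0 m : r m != 0 by rewrite gt_eqF// rest_gt0.
elim: u => [|b u IH] /=; first by rewrite add0r divff// mul0r.
rewrite IH cantor_len_ratio /remove_middle /lam /=.
have E : r (size u) = x (size u).+1 + r (size u).+1 by exact: restS.
have D : x (size u).+1 + r (size u).+1 != 0 by rewrite -E.
case: b; congr (_, _); rewrite ?addr0 ?E; field; rewrite ?D ?r0//.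
Qed.

Lemma word_interval u p : cantor_interval lam (rev u) p <->
  word_sum u <= r 0 * p <= word_sum u + r (size u).
Proof.
rewrite /cantor_interval revK cantor_ends_ratio /= in_itv /=.
by rewrite ler_pdivrMr ?ler_pdivlMr ?rest_gt0// mulrC.
Qed.

(** Each interval lies in that of its shortened word, so by induction the words agree up to the last
    digit; different last digits would put y in two intervals separated by x_(n+1) - r_(n+1) > 0. *)
Lemma word_uniq u v y : size u = size v ->
  word_sum u <= y <= word_sum u + r (size u) ->
  word_sum v <= y <= word_sum v + r (size v) -> u = v.
Proof.
elim: u v => [|b u IH] [|c v] //= [suv].
have E : r (size v) = x (size v).+1 + r (size v).+1 by exact: restS.
have Hx := rest_lt (size v); have Hr := rest_gt0 (size v).+1.
rewrite -/r in Hx.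
rewrite suv => Hu Hv; have {IH} uv : u = v.
  apply: IH => //; first by rewrite suv; move: Hu; case: b; lra.
  by move: Hv; case: c; lra.
by subst v; congr (_ :: _); move: b c Hu Hv => [] [] //; lra.
Qed.

Lemma word_sum_mkseq A n :
  word_sum (rev (mkseq (fun i => i.+1 \in A) n)) = psum x A n.
Proof.
elim: n => [|n IH]; first by rewrite psum0.
by rewrite mkseqS rev_rcons /= IH psumS size_rev size_mkseq.
Qed.

Lemma achievement_central_cantor :
  achievement_set x = dilate (r 0) (central_cantor lam).
Proof.
have r0 := rest_gt0 0.
apply/seteqP; split => [a /achievement_subsum [A ->]|_ [p Cp <-]].
  exists (subsum x A / r 0); last by rewrite mulrC divfK// gt_eqF.
  move=> n _; exists (mkseq (fun i => i.+1 \in A) n).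
    by rewrite /= size_mkseq.
  rewrite -[mkseq _ _]revK; apply/word_interval.
  rewrite word_sum_mkseq size_rev size_mkseq mulrC divfK ?gt_eqF//.
  by rewrite (subsum_ge x_ge0 x_bnd) (subsum_le x_ge0 x_bnd).
have /choice[W HW] : forall n, exists u, size u = n /\
    word_sum u <= r 0 * p <= word_sum u + r (size u).
  have H n : exists u, size u = n.+1 /\
      word_sum u <= r 0 * p <= word_sum u + r (size u).
    have [t st Ht] := Cp n.+1 isT.
    exists (rev t); split; first by rewrite size_rev.
    by apply/word_interval; rewrite revK.
  (* The intersection starts at level 1, so the bound for the empty word is derived from an interval
     of level 1. *)
  case=> [|n]; last exact: H.
  have [u] := H 0%N; case: u => [|b [|c u]] [] // _ /= Hb.
  exists [::]; split=> //=.
  have E : r 0 = x 1%N + r 1%N by exact: restS.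
  have := rest_lt 0; have := rest_gt0 1; rewrite -/r.
  by move: Hb; case: b => /=; lra.
(* Without its last digit, [W n.+1] still labels an interval around the point, by uniqueness that of
   [W n]; hence one set A encodes all the words. *)
have WS n : behead (W n.+1) = W n.
  have [sW] := HW n.+1; have [sWn HWn] := HW n.
  case E : (W n.+1) sW => [|b u] //= [su] Hu.
  apply: (@word_uniq _ _ (r 0 * p)) => //; first by rewrite su.
  have Er : r (size u) = x (size u).+1 + r (size u).+1 by exact: restS.
  have := rest_lt (size u); have := rest_gt0 (size u).+1; rewrite -/r.
  by move: Hu; case: b {E} => /=; lra.
pose A := [set j | head false (W j)].
have WA n : psum x A n = word_sum (W n).
  elim: n => [|n IH].
    by rewrite psum0; have [/size0nil ->] := HW 0%N.
  rewrite psumS IH -WS; have [sW _] := HW n.+1.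
  case E : (W n.+1) sW => [|b u] //= [su].
  have -> : (n.+1 \in A) = b by apply/idP/idP; rewrite inE /A /= E.
  by rewrite su.
have <- : subsum x A = r 0 * p; last exact: subsum_achievement.
apply: (subsum_eq x_ge0 x_bnd) => n.
by rewrite WA; have [sW] := HW n; rewrite sW.
Qed.

(** Carried over from the central Cantor set, an intersection of finite unions of closed intervals
    inside [0, 1]. *)
Lemma achievement_compact : compact (achievement_set x).
Proof.
rewrite achievement_central_cantor.
have -> : dilate (r 0) (central_cantor lam) = *%R (r 0) @` central_cantor lam.
  by [].
apply: continuous_compact; first exact/continuous_subspaceT/mulrl_continuous.
apply: (@subclosed_compact _ _ `[0 : R, 1]%classic); last 2 first.
- exact: segment_compact.
- move=> p /(_ 1%N isT) [[|b [|c t]]] //= _ /(word_interval [:: b] p) /=.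
  have E : r 0 = x 1%N + r 1%N by exact: restS.
  have := rest_lt 0; have := rest_gt0 1; rewrite -/r => r1 x1 h.
  have : 0 <= r 0 * p <= r 0 * 1 by move: h; case: b => /=; lra.
  by rewrite in_itv /= pmulr_rge0 ?ler_pM2l ?rest_gt0.
apply: closed_bigI => n _.
rewrite /cantor_level.
apply: closed_bigcup => [|t _]; last exact: interval_closed.
rewrite (_ : [set t | _] = range (@tval n bool)).
  exact/finite_image/finite_finset.
apply/seteqP; split => [t /eqP st|_ [t _ <-]]; first by exists (Tuple st).
exact: size_tuple.
Qed.

End FastConvergence.

(** * Ends of the nontrivial components of a compact set of reals *)

Section ComponentEnds.
Variable R : realType.
Implicit Types F K : set R.

Lemma compact_sup_mem K : K !=set0 -> compact K -> K (sup K).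
Proof.
move=> K0 cK; have [_ ubK] := compact_has_sup K0 cK.
have clK : closed K by apply: compact_closed cK; exact: Rhausdorff.
by rewrite [X in X (sup K)](closure_id K).1//; exact: closure_sup.
Qed.

(* To the right of [sup K] there are gaps of [F] arbitrarily close to it, and
   their left endpoints are one-point components. *)
Lemma component_sup_limit F p : compact F ->
  (forall u w, F u -> u < w -> (forall y, u < y < w -> ~ F y) ->
     point_components F u) ->
  F p -> let K := connected_component F p in
  K° !=set0 -> limit_point (point_components F) (sup K).
Proof.
move=> cF gap Fp K [c Kc].
have clF : closed F by apply: compact_closed cF; exact: Rhausdorff.
have KF : K `<=` F by exact: connected_component_sub.
have cK : compact K.
  by apply: subclosed_compact cF _ => //; exact: component_closed.
have K0 : K !=set0 by exists c; exact: interior_subset.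
have Kb := compact_sup_mem K0 cK; have [_ ubK] := compact_has_sup K0 cK.
set b := sup K in Kb *.
have Kle y : K y -> y <= b by move=> Ky; exact: ub_le_sup.
have Eb : connected_component F b = K.
  by apply/esym; apply: same_connected_component.
(* A second point of K: it shows at the end that {b} is not a component, so that u differs from
   b. *)
have [a Ka ab] : exists2 a, K a & a < b.
  have /nbhs_ballP[e /= e0 eK] := Kc.
  exists (c - e / 2); last by have := Kle _ (interior_subset Kc); lra.
  by apply: eK; rewrite /ball /= ltr_norml; lra.
move=> U /nbhs_ballP[e /= e0 eU].
(* Otherwise F would contain [b, b + e / 2], and K would extend beyond its supremum. *)
have [q /andP[bq qe] nFq] : exists2 q, b < q < b + e & ~ F q.
  apply: contrapT => H.
  suff : K (b + e / 2) by move=> /Kle; lra.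
  rewrite -Eb; apply: (@connected_component_max _ F `[b, b + e / 2]%classic b).
  - by rewrite /= in_itv /=; lra.
  - move=> y; rewrite /= in_itv /= => /andP[bY ye].
    have [->|nby] := eqVneq y b; first exact: KF.
    apply: contrapT => nFy; apply: H; exists y => //.
    by rewrite lt_neqAle eq_sym nby bY /=; lra.
  - exact: segment_connected.
  - by rewrite /= in_itv /=; lra.
(* The last point u of F before q is the left end of a gap, with b <= u < b + e. *)
pose G := F `&` [set y | y <= q].
have G0 : G !=set0 by exists b; split; [exact: KF|exact: ltW].
have cG : compact G by apply: compact_closedI => //; exact: closed_le.
have [Fu /= uq] := compact_sup_mem G0 cG; have [_ ubG] := compact_has_sup G0 cG.
set u := sup G in Fu uq.
have Gle y : F y -> y <= q -> y <= u by move=> *; exact: ub_le_sup.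
have bu : b <= u by apply: Gle; [exact: KF|exact: ltW].
have {}uq : u < q.
  by rewrite lt_neqAle uq andbT; apply: contra_notN nFq => /eqP <-.
have Pu : point_components F u.
  apply: gap uq _ => // y /andP[uy yq] Fy.
  by have := Gle _ Fy (ltW yq); lra.
exists u; split => //; last by apply: eU; rewrite /ball /= ltr_norml; lra.
apply/eqP => ub; have [_] := Pu; rewrite ub Eb => E.
by have := Ka; rewrite E /= => ab'; rewrite ab' ltxx in ab.
Qed.

Lemma connected_component_opp F p : (forall y, F y -> F (- y)) ->
  connected_component F (- p) = -%R @` connected_component F p.
Proof.
move=> FN.
have sub q z : connected_component F q z -> connected_component F (- q) (- z).
  move=> qz; have Fq : F q.
    by apply: contrapT => nFq; rewrite connected_component_out in qz.
  apply: (@connected_component_max _ F (-%R @` connected_component F q)).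
  - by exists q => //; exact: connected_component_refl.
  - by move=> _ [y /connected_component_sub Fy <-]; exact: FN.
  - apply: connected_continuous_connected; first exact: component_connected.
    by apply: continuous_subspaceT => y; exact: opp_continuous.
  - by exists z.
apply/seteqP; split => [z /sub|_ [z /sub ? <-]//].
by rewrite opprK => ?; exists (- z); rewrite ?opprK.
Qed.

Lemma point_components_opp F y : (forall y, F y -> F (- y)) ->
  point_components F y -> point_components F (- y).
Proof.
move=> FN [Fy E]; split; first exact: FN.
by rewrite connected_component_opp// E image_set1.
Qed.

(** Reflection reduces this to the supremum of the component of -p; by symmetry of F the hypothesis
    on left ends of gaps suffices. *)
Lemma component_inf_limit F p : compact F -> (forall y, F y -> F (- y)) ->
  (forall u w, F u -> u < w -> (forall y, u < y < w -> ~ F y) ->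
     point_components F u) ->
  F p -> let K := connected_component F p in
  K° !=set0 -> limit_point (point_components F) (inf K).
Proof.
move=> cF FN gap Fp K [c Kc].
have := @component_sup_limit F (- p) cF gap (FN _ Fp).
rewrite /= connected_component_opp// -/K => H.
have {}H : limit_point (point_components F) (sup (-%R @` K)).
  apply: H; exists (- c).
  have /nbhs_ballP[e /= e0 eK] := Kc.
  apply/nbhs_ballP; exists e => //= y cy; exists (- y); rewrite ?opprK//.
  apply: eK; move: cy; rewrite /ball /= -normrN; congr (`|_| < _); ring.
rewrite /inf => U U0.
have [y [yb Py Uy]] : exists y, [/\ y != sup (-%R @` K),
    point_components F y & (-%R @^-1` U) y].
  apply: H; have := opp_continuous (sup (-%R @` K)); exact.
exists (- y); split => //; first by rewrite eqr_opp.
exact: point_components_opp.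
Qed.

End ComponentEnds.

(** Such a sequence is nonnegative, and one later strict drop makes it positive; this yields strict
    bounds on tails. *)
Lemma nonincreasing_cvg0_gt0 (R : realType) (g : nat -> R) n :
  nonincreasing_seq g -> g n @[n --> \oo] --> (0 : R) ->
  (exists2 m, (n <= m)%N & g m.+1 < g m) ->
  0 < g n.
Proof.
move=> gn g0 [m nm gm]; apply: lt_le_trans (gn _ _ nm).
apply: le_lt_trans gm; rewrite -(cvg_lim _ g0)//.
apply: nonincreasing_cvgn_ge => //; apply/cvg_ex; by exists 0.
Qed.

(** Dividing i + 1 instead of i by 3 moves the remainders from {0, 1, 2} to {-1, 0, 1}. *)
Lemma balanced_ternary_digit (i : int) : exists a e : int,
  i = 3 * a + e /\ [\/ e = 0, e = 1 | e = -1].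
Proof.
have := divz_eq (i + 1) 3; have := modz_ge0 (i + 1) (isT : 3 != 0 :> int).
have := ltz_pmod (i + 1) (isT : 0 < 3 :> int).
set a := (_ %/ _)%Z; set e := (_ %% _)%Z => e3 e0 ie.
exists a, (e - 1); split; first by lia.
have : e = 0 \/ e = 1 \/ e = 2 by lia.
by case=> [->|[->|->]]; [constructor 3|constructor 1|constructor 2].
Qed.

(** * The ternary weights: the difference set is a Cantorval *)

Section TernaryWeights.
Variables (R : realType) (K : set nat).
Hypothesis K1 : 1%N \notin K.
Hypothesis K_inf : forall n, exists2 m, (n < m)%N & m \in K.
Hypothesis KC_inf : forall n, exists2 m, (n < m)%N & m \notin K.

Let x (j : nat) : R := if j \in K then 2 / 3 ^+ j.-1 else 1 / 3 ^+ j.-1.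
Let q (n : nat) : R := (3 ^+ n)^-1.
Let r := rest x.

Lemma weight_gt0 j : 0 < x j.
Proof. by rewrite /x; case: ifP => _; rewrite divr_gt0// exprn_gt0. Qed.

Lemma weight_ge0 j : 0 <= x j. Proof. exact/ltW/weight_gt0. Qed.

Lemma weightS n : x n.+1 = (if n.+1 \in K then 2 else 1) * q n.
Proof. by rewrite /x /q; case: ifP. Qed.

Lemma invpow3_gt0 n : 0 < q n.
Proof. by rewrite invr_gt0 exprn_gt0. Qed.

Lemma invpow3S n : q n.+1 = q n / 3.
Proof. by rewrite /q exprSr invfM. Qed.

Lemma invpow3_cvg0 : q n @[n --> \oo] --> (0 : R).
Proof.
rewrite (_ : q = fun n => 3^-1 ^+ n).
  by apply: cvg_expr; rewrite ltr_norml; lra.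
by apply/funext => n; rewrite /q exprVn.
Qed.

Lemma weight_bnd n : psum x setT n <= 3.
Proof.
suff : psum x setT n <= 3 - 3 * q n by have := invpow3_gt0 n; lra.
elim: n => [|n IH]; first by rewrite psum0 /q expr0; lra.
rewrite psumS in_setT weightS invpow3S; have := invpow3_gt0 n.
by case: ifP => _; lra.
Qed.

Let r_cvg0 : r n @[n --> \oo] --> (0 : R).
Proof. exact: rest_cvg0 weight_ge0 weight_bnd. Qed.

Let rS n : r n = x n.+1 + r n.+1.
Proof. exact: restS weight_ge0 weight_bnd n. Qed.

(** 3 * q n is the tail with 2 / 3^(j-1) at every j; it exceeds r n by the sum of 3^(1-j) over j > n
    outside K. *)
Lemma weight_rest_lt n : r n < 3 * q n.
Proof.
rewrite -subr_gt0.
apply: (@nonincreasing_cvg0_gt0 _ (fun n => 3 * q n - r n)).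
- apply/nonincreasing_seqP => m; rewrite (rS m) weightS invpow3S.
  by have := invpow3_gt0 m; case: ifP => _; lra.
- rewrite [X in _ --> X](_ : 0 = 3 * 0 - 0 :> R); last by ring.
  apply: cvgB; last exact: r_cvg0.
  by apply: cvgM; [exact: cvg_cst|exact: invpow3_cvg0].
- have [[//|m] nm /negbTE mK] := KC_inf n; exists m => //.
  by rewrite (rS m) weightS mK invpow3S; have := invpow3_gt0 m; lra.
Qed.

(** The difference is the sum of the x_j over j > n in K. *)
Lemma weight_rest_gt n : 3 * q n < 2 * r n.
Proof.
rewrite -subr_gt0.
apply: (@nonincreasing_cvg0_gt0 _ (fun n => 2 * r n - 3 * q n)).
- apply/nonincreasing_seqP => m; rewrite (rS m) weightS invpow3S.
  by have := invpow3_gt0 m; case: ifP => _; lra.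
- rewrite [X in _ --> X](_ : 0 = 2 * 0 - 3 * 0 :> R); last by ring.
  apply: cvgB.
    by apply: cvgM; [exact: cvg_cst|exact: r_cvg0].
  by apply: cvgM; [exact: cvg_cst|exact: invpow3_cvg0].
- have [[//|m] nm mK] := K_inf n; exists m => //.
  by rewrite (rS m) weightS mK invpow3S; have := invpow3_gt0 m; lra.
Qed.

Lemma weight_fast n : rest x n.+1 < x n.+1.
Proof.
rewrite weightS; have := weight_rest_lt n.+1; have := invpow3_gt0 n.
by rewrite invpow3S /r; case: ifP => _; lra.
Qed.

Let E := achievement_set x.
Let F := diff_set E E.

Lemma diff_subsum A B : F (subsum x A - subsum x B).
Proof.
exists (subsum x A); first exact: subsum_achievement.
by exists (subsum x B); first exact: subsum_achievement.
Qed.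

Lemma diff_achievementP y : F y -> exists A B, y = subsum x A - subsum x B.
Proof.
case=> _ /achievement_subsum[A ->] [_ /achievement_subsum[B ->] <-].
by exists A, B.
Qed.

Lemma diff_opp y : F y -> F (- y).
Proof.
by move=> /diff_achievementP[A [B ->]]; rewrite opprB; exact: diff_subsum.
Qed.

Lemma diff_compact : compact F.
Proof.
have cE : compact E := achievement_compact weight_ge0 weight_bnd weight_fast.
have -> : F = (fun p : R * R => p.1 - p.2) @` (E `*` E).
  apply/seteqP; split => [_ [a Ea [b Eb <-]]|_ [[a b] [/= Ea Eb] <-]].
    by exists (a, b).
  by exists a => //; exists b.
apply: continuous_compact; last exact: compact_setX.
apply: continuous_subspaceT => -[a b].
by apply: cvgB; [exact: cvg_fst|exact: cvg_snd].
Qed.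

(** The signed sums of length n: each coefficient in {-1, 0, 1} is a difference of two membership
    bits. *)
Definition level_diff n v := exists A B, v = psum x A n - psum x B n.

Lemma diff_level n v : level_diff n v -> F v.
Proof.
case=> A [B ->].
rewrite -!(subsum_cut weight_ge0 weight_bnd); exact: diff_subsum.
Qed.

Lemma diff_level_top n v : level_diff n v -> F (v + r n).
Proof.
case=> A [B ->].
rewrite addrAC -(subsum_fill weight_ge0 weight_bnd).
rewrite -(subsum_cut weight_ge0 weight_bnd); exact: diff_subsum.
Qed.

(** Only the parts of A and B up to n matter for v, so n + 1 may be put freely into either set. *)
Lemma level_diff_step n v (e : R) : level_diff n v ->
  [\/ e = 0, e = 1 | e = -1] -> level_diff n.+1 (v + e * x n.+1).
Proof.
case=> A [B ->] He.
have cut0 C : psum x [set j | C j /\ (j <= n)%N] n.+1 = psum x C n.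
  by rewrite psum_cut.
have fill1 C : psum x [set j | C j \/ (n < j)%N] n.+1 = psum x C n + x n.+1.
  rewrite psumS psum_fill (_ : _.+1 \in _)// inE /=; right; lia.
case: He => ->.
- by exists [set j | A j /\ (j <= n)%N], [set j | B j /\ (j <= n)%N];
    rewrite !cut0; ring.
- by exists [set j | A j \/ (n < j)%N], [set j | B j /\ (j <= n)%N];
    rewrite cut0 fill1; ring.
- by exists [set j | A j /\ (j <= n)%N], [set j | B j \/ (n < j)%N];
    rewrite cut0 fill1; ring.
Qed.

(** It makes distinct signed sums of length n + 1 differ by at least [q n]. *)
Lemma psum_lattice A n : exists z : int, psum x A n.+1 = z%:~R * q n.
Proof.
elim: n => [|n [z IH]].
  rewrite psumS psum0 add0r weightS (negbTE K1).
  by case: ifP => _; [exists 1|exists 0]; rewrite /=; ring.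
have step (c : int) : z%:~R * q n + c%:~R * q n.+1 = (z * 3 + c)%:~R * q n.+1.
  by rewrite invpow3S rmorphD rmorphM /=; field.
rewrite psumS IH weightS.
case: ifP => _; last first.
  by exists (z * 3 + 0); rewrite -step mul0r.
by case: ifP => _; [exists (z * 3 + 2)|exists (z * 3 + 1)]; rewrite -step.
Qed.

Lemma level_diff_lattice n v : level_diff n.+1 v ->
  exists z : int, v = z%:~R * q n.
Proof.
case=> A [B ->]; have [a ->] := psum_lattice A n.
have [b ->] := psum_lattice B n.
by exists (a - b); rewrite rmorphB /=; ring.
Qed.

(* {-2, 0, 2} and {-1, 0, 1} are both complete residue systems modulo 3. *)
Lemma level_diff_dense N v m (i : int) : N.+1 \notin K -> level_diff N v ->
  `|i| <= 3 ^+ m -> level_diff (N + m).+1 (v + i%:~R * q (N + m)).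
Proof.
move=> NK Nv; elim: m i => [|m IH] i.
  rewrite addn0 expr0 => i1.
  have -> : q N = x N.+1 by rewrite weightS (negbTE NK) mul1r.
  apply: level_diff_step => //.
  have : i = 0 \/ i = 1 \/ i = -1 by lia.
  by case=> [->|[->|->]]; [constructor 1|constructor 2|constructor 3].
rewrite exprS => hi; rewrite addnS.
have [a [e [ie he]]] := balanced_ternary_digit i.
have heR : [\/ e%:~R = 0 :> R, e%:~R = 1 :> R | e%:~R = -1 :> R].
  by case: he => ->; [constructor 1|constructor 2|constructor 3].
(* For an index in K the new coefficient is -e, as 3 a + e = 3 (a + e) + 2 (-e); otherwise it is
   e. *)
have [inK|ninK] := boolP ((N + m).+2 \in K).
  have hNe : [\/ - e%:~R = 0 :> R, - e%:~R = 1 :> R | - e%:~R = -1 :> R].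
    case: heR => ->; rewrite ?oppr0 ?opprK.
    - by constructor 1.
    - by constructor 3.
    - by constructor 2.
  have : `|a + e| <= 3 ^+ m.
    have : e = 0 \/ e = 1 \/ e = -1 by case: he; tauto.
    by move: hi; rewrite ie; set P := 3 ^+ m; lia.
  move=> /IH/level_diff_step /(_ hNe); congr (level_diff _ _).
  by rewrite weightS inK invpow3S ie !rmorphD rmorphM /=; field.
have : `|a| <= 3 ^+ m.
  have : e = 0 \/ e = 1 \/ e = -1 by case: he; tauto.
  by move: hi; rewrite ie; set P := 3 ^+ m; lia.
move=> /IH/level_diff_step /(_ heR); congr (level_diff _ _).
by rewrite weightS (negbTE ninK) invpow3S ie !rmorphD rmorphM /=; field.
Qed.

Lemma invpow3_lt e : 0 < e -> exists n0, forall n, (n0 <= n)%N -> q n < e.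
Proof.
move=> e0.
have /cvgrPdist_lt /(_ e e0) [n0 _ H] := invpow3_cvg0; exists n0 => n n0n.
by have := H n n0n; rewrite /= sub0r normrN gtr0_norm// invpow3_gt0.
Qed.

(** By [level_diff_dense], grids of mesh q (N + m) across [v - q N, v + q N] lie in F for all m; F
    is closed, so it contains a neighbourhood of v. *)
Lemma level_diff_interior N v : N.+1 \notin K -> level_diff N v -> F° v.
Proof.
move=> NK Nv; apply/nbhs_ballP; exists (q N); first exact: invpow3_gt0.
move=> y; rewrite /ball /= => yv.
have clF : closed F by apply: compact_closed diff_compact; exact: Rhausdorff.
apply: clF => U /nbhs_ballP[e /= e0 eU].
have [m Hm] := invpow3_lt e0.
have qm : q (N + m) < e by apply: Hm; exact: leq_addl.
have q0 := invpow3_gt0 (N + m).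
pose i := Num.floor ((y - v) / q (N + m)).
have /andP[il iu] := floor_itv ((y - v) / q (N + m)).
rewrite -/i ler_pdivlMr// in il.
rewrite -/i ltr_pdivrMr// rmorphD /= in iu.
exists (v + i%:~R * q (N + m)); split; last first.
  by apply: eU; rewrite /ball /= ltr_norml; lra.
apply: (@diff_level (N + m).+1); apply: level_diff_dense => //.
have qN : q N = (3 ^+ m)%:~R * q (N + m).
  by rewrite /q exprD invfM mulrCA rmorphXn /= mulfV ?mulr1//.
move: yv; rewrite distrC ltr_norml qN => /andP[yl yu].
set P : int := 3 ^+ m in qN yl yu *.
have iP : i%:~R <= P%:~R :> R.
  by rewrite -(ler_pM2r q0); lra.
have Pi : (- P)%:~R < (i + 1)%:~R :> R.
  by rewrite -(ltr_pM2r q0) rmorphN rmorphD /=; lra.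
by move: iP Pi; rewrite ler_int ltr_int ltzD1 ler_norml => -> ->.
Qed.

Lemma subsum_diff_near A B n :
  `|subsum x A - subsum x B - (psum x A n - psum x B n)| <= r n.
Proof.
have := subsum_ge weight_ge0 weight_bnd A n.
have := subsum_ge weight_ge0 weight_bnd B n.
have := subsum_le weight_ge0 weight_bnd A n.
have := subsum_le weight_ge0 weight_bnd B n.
by rewrite ler_norml /r; lra.
Qed.

(** Truncating both sums just before an index outside K gives an interior point of F at distance at
    most r n < 3 * q n. *)
Lemma diff_regclosed : regclosed F.
Proof.
have clF : closed F by apply: compact_closed diff_compact; exact: Rhausdorff.
apply/seteqP; split => [p Fp|p].
  rewrite (closure_id F).1//; apply: closure_subset Fp; exact: interior_subset.
move=> /diff_achievementP[A [B ->]] U /nbhs_ballP[e /= e0 eU].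
have [n0 Hn0] : exists n0, forall n, (n0 <= n)%N -> q n < e / 3.
  by apply: invpow3_lt; rewrite divr_gt0.
have [[//|n] n0n nK] := KC_inf n0.
exists (psum x A n - psum x B n); split.
  by apply: level_diff_interior nK _; exists A, B.
apply: eU; have := subsum_diff_near A B n; have := Hn0 n n0n.
by rewrite /ball /=; have := weight_rest_lt n; lra.
Qed.

Lemma diff_gap_point u w : F u -> u < w -> (forall y, u < y < w -> ~ F y) ->
  point_components F u.
Proof.
move=> Fu uw gap; split => //.
(* The 6 ensures 2 * r m < 6 * q m < w - u: for a signed sum v within r m of u, v + r m stays below
   w. *)
have [m0 Hm0] : exists m0, forall m, (m0 <= m)%N -> q m < (w - u) / 6.
  by apply: invpow3_lt; rewrite divr_gt0// subr_gt0.
have Fle y : F y -> y < w -> y <= u.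
  move=> Fy yw; rewrite leNgt; apply/negP => uy.
  by apply: (gap y) => //; rewrite uy.
have top m : (m0 <= m)%N -> level_diff m (u - r m).
  move=> m0m; have [A [B uE]] := diff_achievementP Fu.
  have vm : level_diff m (psum x A m - psum x B m) by exists A, B.
  have := Hm0 _ m0m; have := weight_rest_lt m; have := subsum_diff_near A B m.
  rewrite -uE ler_norml => /andP[h1 h2] h3 h4.
  have h5 : psum x A m - psum x B m + r m <= u.
    by apply: Fle; [exact: diff_level_top|lra].
  by rewrite (_ : u - r m = psum x A m - psum x B m)//; lra.
have hole n y : (m0 <= n.+1)%N -> n.+2 \in K ->
    u - x n.+2 < y < u - 2 * r n.+2 -> ~ F y.
  move=> m0n nK yu Fy; have [A [B yE]] := diff_achievementP Fy.
  have vA : level_diff n.+1 (psum x A n.+1 - psum x B n.+1) by exists A, B.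
  have := Hm0 _ m0n; have := weight_rest_lt n.+1.
  have := subsum_diff_near A B n.+1.
  rewrite -yE ler_norml => /andP[h1 h2] h3 h4.
  have r2 := rest_ge0 weight_ge0 weight_bnd n.+2; rewrite -/r in r2.
  have h5 : psum x A n.+1 - psum x B n.+1 + r n.+1 <= u.
    by apply: Fle; [exact: diff_level_top|lra].
  have xE : x n.+2 = 2 * q n / 3.
    by rewrite weightS nK invpow3S mulrA.
  have q0 := invpow3_gt0 n.
  (* The left side exceeds u - r_(n+1) - x_(n+2) and is at most u - r_(n+1); as x_(n+2) = 2/3 * q n
     is below the mesh [q n], only one lattice point is possible. *)
  have vu : psum x A n.+1 - psum x B n.+1 = u - r n.+1.
    have [a aE] := level_diff_lattice vA.
    have [b bE] := level_diff_lattice (top _ m0n).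
    rewrite aE bE; congr (_%:~R * _); apply/eqP; rewrite eq_le.
    have : a%:~R <= b%:~R :> R by rewrite -(ler_pM2r q0) -aE -bE; lra.
    have : b%:~R < (a + 1)%:~R :> R.
      by rewrite -(ltr_pM2r q0) rmorphD /= mulrDl -aE -bE; lra.
    by rewrite ltr_int ltzD1 ler_int => -> ->.
  have rn := rS n.+1.
  have hA1 := subsum_ge weight_ge0 weight_bnd A n.+2.
  have hB1 := subsum_ge weight_ge0 weight_bnd B n.+2.
  have hA2 := subsum_le weight_ge0 weight_bnd A n.+2.
  have hB2 := subsum_le weight_ge0 weight_bnd B n.+2.
  move: hA1 hB1 hA2 hB2; rewrite -/r (psumS x A n.+1) (psumS x B n.+1).
  have x0 := weight_gt0 n.+2.
  clear -yE vu rn yu r2 x0.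
  (* Coefficient 1 at n + 2 forces y >= u - 2 r_(n+2); coefficients 0 and -1 force y <= u -
     x_(n+2). *)
  by case: ifP => _; case: ifP => _; lra.
have itvC : is_interval (connected_component F u).
  by apply/connected_intervalP; exact: component_connected.
have Cu : connected_component F u u by exact: connected_component_refl.
apply/seteqP; split => [c Cc|_ ->//].
have Fc := connected_component_sub Cc.
rewrite /=; apply/eqP; rewrite eq_le; apply/andP; split.
  apply: Fle => //; rewrite ltNge; apply/negP => wc.
  apply: (gap ((u + w) / 2)); first by lra.
  by apply: (@connected_component_sub _ F u); apply: (itvC u c) => //; lra.
rewrite leNgt; apply/negP => cu.
have [n1 Hn1] : exists n1, forall m, (n1 <= m)%N -> q m < (u - c) / 2.
  by apply: invpow3_lt; rewrite divr_gt0// subr_gt0.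
have [[|[|n]] // nn nK] := K_inf (maxn m0 n1).+1.
have qn : q n.+1 < (u - c) / 2 by apply: Hn1; lia.
have xE : x n.+2 = 2 * q n.+1 by rewrite weightS nK.
have rx := weight_rest_lt n.+2.
have q0 := invpow3_gt0 n.+1; rewrite invpow3S in rx.
(* The midpoint of the hole; it lies above c because x_(n+2) = 2 * q (n+1) < u - c. *)
apply: (hole n (u - (x n.+2 + 2 * r n.+2) / 2)) => //; [lia|lra|].
apply: (@connected_component_sub _ F u); apply: (itvC c u) => //.
by have := rest_ge0 weight_ge0 weight_bnd n.+2; rewrite -/r; lra.
Qed.

Lemma diff_cantorval : cantorval F.
Proof.
have cF := diff_compact; split.
- by exists (subsum x set0 - subsum x set0); exact: diff_subsum.
- exact: diff_regclosed.
- exact: compact_bounded.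
- move=> p Fp C C0; split.
    exact: component_inf_limit cF diff_opp diff_gap_point Fp C0.
  exact: component_sup_limit cF diff_gap_point Fp C0.
Qed.

End TernaryWeights.

(** This limit fixes the constant left free by the linear system in the uniqueness proof. *)
Lemma cantor_len_cvg0 (R : realType) (mu : nat -> R) :
  (forall j, posnat j -> 0 < mu j < 1 / 2) ->
  cantor_len mu n @[n --> \oo] --> (0 : R).
Proof.
move=> hmu.
have bnd n : 0 <= cantor_len mu n <= (1 / 2) ^+ n.
  elim: n => [|n /andP[d0 d1]].
    by rewrite /cantor_len big_geq// expr0 ler01 lexx.
  rewrite /cantor_len big_nat_recr//= -/(cantor_len mu n).
  have /andP[m0 m1] := hmu n.+1 isT.
  by rewrite mulr_ge0 ?(ltW m0)//= exprSr ler_pM// ltW.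
apply: (@squeeze_cvgr _ _ _ _ (fun=> 0) (fun n => (1 / 2) ^+ n)).
- by near=> n; exact: bnd.
- exact: cvg_cst.
- by apply: cvg_expr; rewrite ltr_norml; lra.
Unshelve. all: by end_near. Qed.

(** * Existence and uniqueness of the solution of the system for lambda *)

Section LambdaSystem.
Variables (R : realType) (k : nat -> nat).
Hypothesis k_0 : k 0%N = 0%N.
Hypothesis k_incr : forall m n, posnat m -> (m < n)%N -> (k m < k n)%N.
Hypothesis k_1 : (1 < k 1)%N.
Hypothesis coinf : infinite_set (posnat `\` k @` posnat).

Let K := k @` posnat.
Let x (j : nat) : R := if j \in K then 2 / 3 ^+ j.-1 else 1 / 3 ^+ j.-1.
Let q (n : nat) : R := (3 ^+ n)^-1.
Let r := rest x.
Let lam n := r n / r n.-1.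

Lemma index_lt m n : (m < n)%N -> (k m < k n)%N.
Proof.
case: m => [n0|m]; last exact: k_incr.
rewrite k_0; case: n n0 => [//|[|n] _]; first exact: ltnW.
exact: ltn_trans (ltnW k_1) (@k_incr 1 n.+2 isT isT).
Qed.

Lemma index_le m n : (m <= n)%N -> (k m <= k n)%N.
Proof. by rewrite leq_eqVlt => /orP[/eqP ->//|/index_lt/ltnW]. Qed.

Lemma index_ge n : (n <= k n)%N.
Proof. by elim: n => // n IH; exact: leq_ltn_trans (index_lt (ltnSn n)). Qed.

Lemma index_mem n : (0 < n)%N -> k n \in K.
Proof. by move=> n0; rewrite inE; exists n. Qed.

Lemma index_gap n j : (k n.-1 < j < k n)%N -> j \notin K.
Proof.
move=> jn; apply/negP; rewrite inE => -[i i0 kij]; subst j.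
have [ni|ni] := leqP n i; first by have := index_le ni; lia.
have /index_le : (i <= n.-1)%N by lia.
lia.
Qed.

Let K1 : 1%N \notin K.
Proof. by apply: (@index_gap 1); rewrite k_0. Qed.

Let K_inf n : exists2 m, (n < m)%N & m \in K.
Proof. by exists (k n.+1); [exact: index_ge|exact: index_mem]. Qed.

Let KC_inf n : exists2 m, (n < m)%N & m \notin K.
Proof.
apply: contrapT => H; apply: coinf.
apply: (sub_finite_set _ (finite_II n.+1)) => j [j0 jK] /=.
rewrite ltnS leqNgt; apply/negP => nj; apply: H; exists j => //.
by apply/negP; rewrite inE.
Qed.

Let qS n : q n.+1 = q n / 3. Proof. exact: invpow3S. Qed.
Let xS n : x n.+1 = (if n.+1 \in K then 2 else 1) * q n.
Proof. exact: weightS. Qed.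
Let x_ge0 j : 0 <= x j. Proof. exact: weight_ge0. Qed.
Let x_bnd n : psum x setT n <= 3. Proof. exact: weight_bnd. Qed.
Let x_fast n : rest x n.+1 < x n.+1. Proof. exact: weight_fast KC_inf n. Qed.
Let rS n : r n = x n.+1 + r n.+1. Proof. exact: restS x_ge0 x_bnd n. Qed.
Let r_lt n : r n < 3 * q n. Proof. exact: weight_rest_lt. Qed.
Let r_gt n : 3 * q n < 2 * r n. Proof. exact: weight_rest_gt. Qed.
Let r_gt0 n : 0 < r n. Proof. exact: rest_gt0 x_ge0 x_bnd x_fast n. Qed.
Let r_neq0 n : r n != 0. Proof. exact/lt0r_neq0/r_gt0. Qed.

(* The sum of the x_j with j in K and j > m, hence constant between two
   consecutive elements of K; this is the delta of the system, up to S. *)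
Let gam m : R := 2 * r m - 3 * q m.

Lemma gam_const n m : (k n.-1 <= m < k n)%N -> gam m = gam (k n.-1).
Proof.
case/andP => /subnKC <-; elim: (m - k n.-1)%N => [|d IH].
  by rewrite addn0.
rewrite addnS => h; rewrite -IH; last by lia.
have /negbTE nK : (k n.-1 + d).+1 \notin K by apply: (@index_gap n); lia.
by rewrite /gam (rS (_ + d)) xS nK qS; field.
Qed.

Lemma lambda_conditions_ratio : lambda_conditions k lam.
Proof.
have dE : cantor_len lam = fun n => r n / r 0.
  by apply/funext => n; exact: cantor_len_ratio x_ge0 x_bnd x_fast n.
(* lam_(j+1) > 1/3 amounts to x_(j+1) < 2 r_(j+1), which for an index outside K is the lower tail
   bound. *)
have lam_notin j : j.+1 \notin K -> 1 / 3 < lam j.+1.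
  move=> /negbTE jK; rewrite /lam /= ltr_pdivlMr// (rS j) xS jK.
  by have := r_gt j.+1; rewrite qS; lra.
split.
- case=> // j _; rewrite /lam /= divr_gt0//= ltr_pdivrMr// (rS j).
  by have := x_fast j; rewrite -/r; lra.
- exact: lam_notin.
- move=> n n0; have := index_mem n0; have := index_ge n.
  case: (k n) => [|j] h jK; first by move: n0; rewrite /posnat /=; lia.
  rewrite /lam /= ltr_pdivrMr// (rS j) xS jK.
  by have := r_lt j.+1; rewrite qS; lra.
- case=> // j _ jK; apply/ltW/lam_notin; apply/negP; rewrite inE; exact: jK.
exists (fun n => gam (k n.-1) / r 0) => n n0; rewrite /= dE.
have step : (k n).-1.+1 = k n.
  by rewrite prednK//; exact: leq_trans (index_ge n).
(* Reading delta_n at k_n - 1 instead of k_(n-1) reduces both equations at k_n to one step of the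
   tail recursion. *)
have gk : gam (k n).-1 = gam (k n.-1).
  apply: gam_const; have : (k n.-1 < k n)%N by apply: index_lt; rewrite prednK.
  by lia.
have kK := index_mem n0.
split.
- case=> [|m] hm; first by lia.
  have /negbTE nK := index_gap hm.
  rewrite -(@gam_const n m.+1); last by lia.
  by rewrite /= (rS m) xS nK /gam qS; field; rewrite r_neq0.
- rewrite -gk; move: step kK; set m := (k n).-1 => <- kK.
  by rewrite /gam (rS m) xS kK qS; field; rewrite r_neq0.
- rewrite -gk; move: step kK; set m := (k n).-1 => <- kK.
  by rewrite /gam (rS m) xS kK qS; field; rewrite r_neq0.
Qed.

(* The quantity d_m - delta_n / 2 with k_{n-1} <= m < k_n is divided by 3 at
   every step, so that d_m - d_{m+1} is a fixed multiple of x_{m+1}. *)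
Lemma lambda_conditions_unique mu : lambda_conditions k mu ->
  forall j, posnat j -> mu j = lam j.
Proof.
move=> [hmu _ _ _ [delta hd]].
set d := cantor_len mu in hd.
have d0 : d 0%N = 1 by rewrite /d /cantor_len big_geq.
pose C := 1 - delta 1%N / 2.
have inv m : exists n, [/\ (0 < n)%N, (k n.-1 <= m < k n)%N &
    d m - delta n / 2 = C * q m].
  elim: m => [|m [n [n0 mn IH]]].
    exists 1%N; rewrite k_0 /= d0 /q expr0 invr1 mulr1.
    by split => //; exact: ltnW.
  have [h1 h2 h3] := hd n n0; rewrite qS.
  have [mk|mk] : (m.+1 < k n)%N \/ m.+1 = k n by lia.
    exists n; split => //; first by lia.
    by have := h1 m.+1; rewrite /= => /(_ ltac:(lia)); lra.
  (* At k_n the two equations combine to 3 (d_(k_n) - delta_(n+1) / 2) = d_(k_n - 1) - delta_n / 2,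
     so the factor 1/3 survives the change of delta. *)
  exists n.+1; split => //; first by rewrite /= mk leqnn index_lt.
  by move: h2 h3; rewrite -mk /=; lra.
have dS m : d m - d m.+1 = 2 * C / 3 * x m.+1.
  have [n [n0 mn Hn]] := inv m; have [h1 h2 h3] := hd n n0; rewrite xS.
  have [mk|mk] : (m.+1 < k n)%N \/ m.+1 = k n by lia.
    have -> : m.+1 \in K = false by apply/negbTE/(@index_gap n); lia.
    by have := h1 m.+1; rewrite /= => /(_ ltac:(lia)); lra.
  rewrite mk index_mem// -mk.
  by move: h2 h3; rewrite -mk /=; lra.
have dE m : d m = 1 - 2 * C / 3 * psum x setT m.
  elim: m => [|m IH]; first by rewrite d0 psum0 mulr0 subr0.
  by rewrite psumS in_setT; have := dS m; lra.
have lim1 : d n @[n --> \oo] --> (0 : R) by exact: cantor_len_cvg0.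
have lim2 : d n @[n --> \oo] --> 1 - 2 * C / 3 * r 0.
  rewrite (_ : d = fun n => 1 - 2 * C / 3 * psum x setT n); last exact/funext.
  rewrite /r (rest0E x_ge0 x_bnd).
  apply: cvgB; first exact: cvg_cst.
  by apply: cvgM; [exact: cvg_cst|exact: psum_cvg].
(* Both limits of d agree, which determines C and gives d_m = r_m / r_0. *)
have Cr : 0 = 1 - 2 * C / 3 * r 0 by exact: cvg_unique lim1 lim2.
have dr m : d m = r m / r 0.
  have psE : psum x setT m = r 0 - r m.
    by rewrite /r (rest0E x_ge0 x_bnd) (restE x_ge0 x_bnd m); ring.
  apply: (mulIf (r_neq0 0)); rewrite divfK// dE psE.
  set A := 2 * C / 3 in Cr *; have Ar : A * r 0 = 1 by lra.
  by rewrite mulrBr Ar subKr mulrAC Ar mul1r.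
case=> // j _; have := dr j.+1; rewrite /d /cantor_len big_nat_recr//=.
rewrite -/(cantor_len mu j) -/d dr => /esym H.
have rr0 : r j / r 0 != 0 by rewrite mulf_neq0 ?invr_eq0.
by apply: (mulfI rr0); rewrite -H /lam /=; field; rewrite !r_neq0.
Qed.

Lemma lambda_cantorval :
  cantorval (diff_set (achievement_set x) (achievement_set x)) /\
  achievement_set x = dilate (r 0) (central_cantor lam).
Proof.
split; first exact: diff_cantorval.
exact: achievement_central_cantor x_ge0 x_bnd x_fast.
Qed.

End LambdaSystem.

Theorem theorem3p4 (R : realType) (k : nat -> nat)
  (k_0 : k 0%N = 0%N)
  (k_incr : forall m n, posnat m -> (m < n)%N -> (k m < k n)%N)
  (k_1 : (1 < k 1)%N)
  (coinf : infinite_set (posnat `\` k @` posnat)) :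
  let x : nat -> R := fun j =>
    if j \in k @` posnat then 2 / 3 ^+ j.-1 else 1 / 3 ^+ j.-1 in
  let S : R := \big[+%R/0]_(1 <= j <oo) x j in
  let r : nat -> R := fun n => \big[+%R/0]_(n.+1 <= j <oo) x j in
  let lam : nat -> R := fun n => r n / r n.-1 in
  (lambda_conditions k lam /\
   forall mu : nat -> R, lambda_conditions k mu ->
     forall j, posnat j -> mu j = lam j) /\
  (cantorval (diff_set (achievement_set x) (achievement_set x)) /\
   achievement_set x = dilate S (central_cantor lam)).
Proof.
split; last exact: lambda_cantorval.
split; first exact: lambda_conditions_ratio.
exact: lambda_conditions_unique.
Qed.
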